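(* Let $k\ge 2$ be an integer and let $I_k$ be a nonempty subset of $\{1,\dots,k-1\}$. For a ratio $r>0$, let $X_\delta$ denote the number of $\delta$-solutions of a random instance $I_k(\lfloor rn\rfloor,n)$. Then there exist a real $r^*_{I_k}>0$ and a real $0<\delta<1$ such that for every $0<r<r^*_{I_k}$, \[ \lim_{n\to\infty}\frac{\mathbf{E}[X_\delta]^2}{\mathbf{E}[X_\delta^2]}>0 . \]
   Context: Problem $CSP(I_k)$: given $n$ boolean variables $x_1,\dots,x_n$, a constraint is a $k$-tuple of variables $(x_{i_1},\dots,x_{i_k})$; it is satisfied by an assignment $\sigma:\{x_1,\dots,x_n\}\to\{0,1\}$ iff the number of coordinates $j$ with $\sigma(x_{i_j})=1$ belongs to $I_k$. An instance (a conjunction of constraints) is satisfied by $\sigma$ iff every constraint is satisfied. Random model: $I_k(m,n)$ is the random instance on $n$ variables formed by drawing $m$ constraints independently, uniformly at random and with replacement, each constraint being a uniformly random ordered $k$-tuple of the $n$ variables. For $\delta\in[0,1]$, a $\delta$-valuation is an assignment with exactly $\lfloor\delta n\rfloor$ variables equal to $1$; a $\delta$-solution of an instance is a $\delta$-valuation satisfying it. *)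

(* Defs.v *)
From HB Require Import structures.
From mathcomp Require Import all_boot all_order all_algebra.
From mathcomp Require Import all_classical all_reals topology normedtype sequences.
Set Implicit Arguments. Unset Strict Implicit. Unset Printing Implicit Defensive.
Import Order.TTheory GRing.Theory Num.Theory.
Local Open Scope ring_scope.

Definition valuation (n : nat) := {ffun 'I_n -> bool}.

Definition ones n (s : valuation n) : nat := #|[set i | s i]|.

(* A constraint: an ordered k-tuple of variables (repetitions allowed). *)
Definition constraint (n k : nat) := {ffun 'I_k -> 'I_n}.

(* An instance: a sequence of m constraints (drawn with replacement). *)
Definition instance (n k m : nat) := {ffun 'I_m -> constraint n k}.

Definition sat_constraint (I : pred nat) n k (s : valuation n)
  (c : constraint n k) : bool := I #|[set j | s (c j)]|.

Definition sat_instance (I : pred nat) n k m (s : valuation n)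
  (F : instance n k m) : bool := [forall l, sat_constraint I s (F l)].

Definition nsol (I : pred nat) n k m (d : nat) (F : instance n k m) : nat :=
  #|[set s : valuation n | (ones s == d) && sat_instance I s F]|.

Definition EX {R : realType} (I : pred nat) n k m d : R :=
  (\sum_(F : instance n k m) (nsol I d F)%:R) / (#|{: instance n k m}|)%:R.

Definition EX2 {R : realType} (I : pred nat) n k m d : R :=
  (\sum_(F : instance n k m) ((nsol I d F)%:R ^+ 2)) / (#|{: instance n k m}|)%:R.

Definition moment_ratio {R : realType} (I : pred nat) (k : nat) (r delta : R)
  (n : nat) : R :=
  let m := Num.trunc (r * n%:R) in
  let d := Num.trunc (delta * n%:R) in
  (EX I n k m d) ^+ 2 / EX2 I n k m d.

(* Main.v *)
Require Import Defs.
From HB Require Import structures.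
From mathcomp Require Import all_boot all_order all_algebra.
From mathcomp Require Import all_classical all_reals topology normedtype sequences.
From mathcomp Require Import derive exp perm polyrcf ring lra.
Import Order.TTheory GRing.Theory Num.Theory numFieldNormedType.Exports.
Local Open Scope ring_scope.

(** Second moment method.  The probability that a random constraint is
    satisfied by two valuations [s], [t] of weight [d] is
    [\sum_S A_S(d/n)^2 (y/n)^|S|], where [S] ranges over the subsets of the [k]
    positions, [y] is the deviation of the overlap of [s] and [t] from its mean
    [d^2/n], and [A_S] is a polynomial; [A_0 = g] is the probability that one
    valuation satisfies the constraint and [\sum_j A_{j} = g'].  Choosing [delta]
    as a critical point of [g] (Rolle) kills the term linear in [y] up to
    rounding, so [E[X^2] / E[X]^2] is the average of [(1 + O(y^2/n^2 + 1/n^2))^m] over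
    pairs of valuations.  The binomial expansion reduces its convergence to
    that of the moments of [y / sqrt n], with a geometric domination when [r] is
    small.  Both facts come from the reversible chain that exchanges a one and
    a zero of [t]: tested on [y^s] it gives a recursion for the moments, tested
    on [exp (y^2 / 32n)] it bounds the average of this function.  The limit is
    at least [1] by Cauchy-Schwarz. *)

(** * The level polynomials [A_S] *)

Section LevelPolynomials.
Variable R : realType.

Definition bern (b : bool) : {poly R} := if b then 'X else 1 - 'X.
Definition bsign (b : bool) : R := if b then 1 else -1.

(** Positions outside [S] carry the Bernoulli weight of their value; positions in [S] carry its
    derivative, which is the sign [bsign]. For empty [S] this is the polynomial [g]. *)
Definition level (I : pred nat) (k : nat) (S : {set 'I_k}) : {poly R} :=
  \sum_(x : {ffun 'I_k -> bool})
    (I #|[set j | x j]|)%:R *: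
    \prod_j (if j \in S then (bsign (x j))%:P else bern (x j)).

Lemma horner_bern b z : (bern b).[z] = if b then z else 1 - z.
Proof. by case: b; rewrite /= ?hornerD ?hornerN hornerX ?hornerC. Qed.

Lemma deriv_bern b : (bern b)^`() = (bsign b)%:P.
Proof. by case: b; rewrite /= ?derivB ?derivX ?derivC ?sub0r ?polyCN. Qed.

Lemma deriv_prod (J : finType) (P : pred J) (F : J -> {poly R}) :
  (\prod_(j | P j) F j)^`()
  = \sum_(i | P i) \prod_(j | P j) (if j == i then (F j)^`() else F j).
Proof.
have H (s : seq J) : uniq s -> (\prod_(j <- s) F j)^`()
    = \sum_(i <- s) \prod_(j <- s) (if j == i then (F j)^`() else F j).
  elim: s => [|a s IH] /=; first by rewrite !big_nil derivC.
  case/andP=> nas us; rewrite !big_cons derivM eqxx; congr (_ * _ + _).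
    rewrite !big_seq; apply: eq_bigr => j js.
    by case: eqP => // ja; rewrite -ja js in nas.
  rewrite IH // mulr_sumr !big_seq; apply: eq_bigr => i is_.
  rewrite big_cons; case: eqP => // ai; by rewrite ai is_ in nas.
rewrite -big_filter H ?filter_uniq ?index_enum_uniq //.
rewrite big_filter; apply: eq_bigr => i _; by rewrite big_filter.
Qed.

(** By Leibniz, each term of the derivative hits one position [i], where the Bernoulli weight turns
    into its sign. *)
Lemma deriv_level0 I k :
  (level I k finset.set0)^`() = \sum_(i < k) level I k [set i].
Proof.
rewrite /level raddf_sum exchange_big /=; apply: eq_bigr => x _.
rewrite derivZ -scaler_sumr; congr (_ *: _).
rewrite deriv_prod; apply: eq_bigr => i _; apply: eq_bigr => j _.
by rewrite !finset.inE deriv_bern.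
Qed.

(** Satisfaction depends only on the number of ones, so transposing positions [i] and [i'] permutes
    the terms of the sum. *)
Lemma level1_sym I k (i i' : 'I_k) : level I k [set i] = level I k [set i'].
Proof.
rewrite /level.
pose p (x : {ffun 'I_k -> bool}) := [ffun j => x (tperm i i' j)].
have pK : involutive p by move=> x; apply/ffunP=> j; rewrite !ffunE tpermK.
rewrite (reindex_inj (inv_inj pK)); apply: eq_bigr => x _.
congr (_ *: _).
  congr ((I _)%:R).
  rewrite -(card_imset _ (@perm_inj _ (tperm i i'))); apply: eq_card => j.
  apply/imsetP/idP => [[a]|]; rewrite !finset.inE ?ffunE.
    by move=> xa ->.
  by move=> xj; exists (tperm i i' j); rewrite ?finset.inE ?ffunE tpermK.
rewrite (reindex_inj (@perm_inj _ (tperm i i'))); apply: eq_bigr => j _.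
rewrite ffunE tpermK !finset.inE.
by rewrite (can2_eq (tpermK i i') (tpermK i i')) tpermL.
Qed.

(** By symmetry [g'] is [k] times the level polynomial of any singleton, and [k > 0] because [i]
    exists. *)
Lemma level1_root I k (z : R) (i : 'I_k) :
  (level I k finset.set0)^`().[z] = 0 -> root (level I k [set i]) z.
Proof.
rewrite deriv_level0 (eq_bigr (fun=> level I k [set i])); last first.
  by move=> j _; apply: level1_sym.
rewrite sumr_const card_ord hornerMn => /eqP; rewrite mulrn_eq0.
by rewrite (gtn_eqF (leq_ltn_trans _ (ltn_ord i))).
Qed.

Lemma level0_horner I k (z : R) : (level I k finset.set0).[z] =
  \sum_(x : {ffun 'I_k -> bool})
    (I #|[set j | x j]|)%:R * \prod_j (bern (x j)).[z].
Proof.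
rewrite horner_sum; apply: eq_bigr => x _; rewrite hornerZ horner_prod.
by congr (_ * _); apply: eq_bigr => j _; rewrite finset.in_set0.
Qed.

Lemma bern_ge0 b (z : R) : 0 <= z <= 1 -> 0 <= (bern b).[z].
Proof. by case: b; rewrite horner_bern => /andP[]; lra. Qed.

Lemma bern_gt0 b (z : R) : 0 < z < 1 -> 0 < (bern b).[z].
Proof. by case: b; rewrite horner_bern => /andP[]; lra. Qed.

Lemma level0_gt0 (I : pred nat) k j (z : R) : I j -> (j <= k)%N -> 0 < z < 1 ->
  0 < (level I k finset.set0).[z].
Proof.
move=> Ij jk z01; rewrite level0_horner.
have z01' : 0 <= z <= 1 by case/andP: z01 => /ltW -> /ltW ->.
(* One pattern with exactly [j] ones has positive weight; the others contribute nonnegative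
   terms. *)
pose x : {ffun 'I_k -> bool} := [ffun i : 'I_k => (i < j)%N].
rewrite (bigD1 x) //=; apply: ltr_pwDl.
  have -> : #|[set i | x i]| = j.
    rewrite cardsE -sum1_card (eq_bigl (fun i : 'I_k => (i < j)%N)).
      by rewrite -(big_ord_widen _ (fun=> 1%N)) // sum1_card card_ord.
    by move=> i; rewrite [LHS]ffunE.
  by rewrite Ij mul1r; apply: prodr_gt0 => i _; apply: bern_gt0.
apply: sumr_ge0 => y _; rewrite mulr_ge0 ?ler0n //.
by apply: prodr_ge0 => i _; apply: bern_ge0.
Qed.

(** At density 0 or 1 only a constant pattern has nonzero weight, and its number of ones, 0 or [k],
    is excluded from [I]. *)
Lemma level0_eq0 (I : pred nat) k (b : bool) : (forall j, I j -> (0 < j < k)%N) ->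
  (level I k finset.set0).[b%:R] = 0 :> R.
Proof.
move=> HI; rewrite level0_horner big1 // => x _.
have [/HI/andP[c0 ck]|] := boolP (I #|[set j | x j]|); last by rewrite mul0r.
suff [j xj] : exists j, x j != b.
  rewrite (bigD1 j) //= [X in _ * (X * _)](_ : _ = 0) ?mul0r ?mulr0 //.
  by rewrite horner_bern; move: xj; case: (x j) b => [] [] //= _; lra.
apply/existsP; apply: contraLR ck; rewrite negb_exists => /forallP xb.
case: b xb => xb.
  rewrite -leqNgt -[leqLHS]card_ord; apply: subset_leq_card.
  by apply/fintype.subsetP => j _; rewrite finset.inE; have := xb j; rewrite negbK => /eqP.
suff /eqP : #|[set j | x j]| = 0%N by rewrite (gtn_eqF c0).
apply: eq_card0 => j; rewrite finset.inE; have := xb j; rewrite negbK => /eqP -> //.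
Qed.

(** Rolle applies because [g] vanishes at both ends of the unit interval. *)
Lemma level0_critical (I : pred nat) k j :
  I j -> (forall j, I j -> (0 < j < k)%N) ->
  exists z : R, [/\ 0 < z < 1, 0 < (level I k finset.set0).[z] &
    forall i : 'I_k, root (level I k [set i]) z].
Proof.
move=> Ij HI.
have e : (level I k finset.set0).[0] = (level I k finset.set0).[1].
  by rewrite (level0_eq0 _ _ false) // (level0_eq0 _ _ true).
have [z] := poly_rolle ltr01 e; rewrite in_itv /= => z01 dz; exists z; split=> //.
  by apply: (level0_gt0 _ _ j) => //; case/andP: (HI _ Ij) => _ /ltnW.
by move=> i; apply: level1_root.
Qed.

End LevelPolynomials.

(** * First and second moments *)

Section MomentFormulas.
Variable R : realType.

Definition slice (n d : nat) : {set valuation n} := [set s | ones s == d].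
Definition overlap {n} (s t : valuation n) : nat := #|[set i | s i && t i]|.
Definition dev {n} (s t : valuation n) : R :=
  (overlap s t)%:R - (ones s)%:R * (ones t)%:R / n%:R.

Lemma natr_card (T : finType) (P : pred T) :
  #|[set i | P i]|%:R = \sum_i (P i)%:R :> R.
Proof.
rewrite cardsE -sum1_card natr_sum big_mkcond; apply: eq_bigr => i _.
by rewrite unfold_in; case: (P i).
Qed.

(** Group the tuples by their pattern of labels: the coordinates are free, so a pattern occurs as
    often as the product of the sizes of its label classes. *)
Lemma sum_comp_label (T : finType) n k (lam : 'I_n -> T) (F : {ffun 'I_k -> T} -> R) :
  \sum_(c : {ffun 'I_k -> 'I_n}) F [ffun j => lam (c j)]
  = \sum_x F x * \prod_j (\sum_i (lam i == x j)%:R).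
Proof.
under [RHS]eq_bigr => x _ do rewrite bigA_distr_bigA /= mulr_sumr.
rewrite exchange_big; apply: eq_bigr => c _ /=.
rewrite (bigD1 [ffun j => lam (c j)]) //= big1 => [|j _]; last by rewrite ffunE eqxx.
rewrite mulr1 big1 ?addr0 // => x xc.
have [j xj] : exists j, lam (c j) != x j.
  apply/existsP; apply: contraNT xc; rewrite negb_exists => /forallP H.
  by apply/eqP/ffunP => j; rewrite ffunE; apply/eqP; have := H j; rewrite negbK eq_sym.
by rewrite (bigD1 j) //= (negbTE xj) mul0r mulr0.
Qed.

Lemma count_label1 n (s : valuation n) b : (0 < n)%N ->
  \sum_i (s i == b)%:R = n%:R * (bern R b).[(ones s)%:R / n%:R].
Proof.
move=> n0; have n0' : n%:R != 0 :> R by rewrite pnatr_eq0 -lt0n.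
have e : (ones s)%:R = \sum_i (s i)%:R :> R by rewrite natr_card.
case: b; rewrite horner_bern.
  by rewrite mulrC divfK // e; apply: eq_bigr => i _; case: (s i).
rewrite mulrBr mulr1 mulrC divfK // e.
rewrite -[in n%:R](card_ord n) -sum1_card natr_sum -sumrB; apply: eq_bigr => i _.
by case: (s i) => /=; rewrite ?subrr ?subr0.
Qed.

(** The four counts form a 2 by 2 table with prescribed margins, so they have one degree of freedom.
    It is [dev s t], the departure from independence, and it enters each cell up to sign. *)
Lemma count_label2 n (s t : valuation n) b : (0 < n)%N ->
  \sum_i ((s i, t i) == b)%:R =
  n%:R * (dev s t / n%:R * bsign R b.1 * bsign R b.2
    + (bern R b.1).[(ones s)%:R / n%:R] * (bern R b.2).[(ones t)%:R / n%:R]).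
Proof.
move=> n0; have n0' : n%:R != 0 :> R by rewrite pnatr_eq0 -lt0n.
have Hs b1 := count_label1 _ s b1 n0.
have Ht b1 := count_label1 _ t b1 n0.
have eo : (overlap s t)%:R = \sum_i ((s i, t i) == (true, true))%:R :> R.
  rewrite natr_card; apply: eq_bigr => i _; by case: (s i); case: (t i).
have e1 b1 : \sum_i ((s i, t i) == (b1, true))%:R + \sum_i ((s i, t i) == (b1, false))%:R
   = \sum_i (s i == b1)%:R :> R.
  rewrite -big_split; apply: eq_bigr => i _ /=.
  by case: (s i); case: (t i); case: b1; rewrite /= ?addr0 ?add0r.
have e2 b1 : \sum_i ((s i, t i) == (true, b1))%:R + \sum_i ((s i, t i) == (false, b1))%:R
   = \sum_i (t i == b1)%:R :> R.
  rewrite -big_split; apply: eq_bigr => i _ /=.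
  by case: (s i); case: (t i); case: b1; rewrite /= ?addr0 ?add0r.
have := e1 true; have := e1 false; have := e2 true; have := e2 false.
rewrite !Hs !Ht -eo.
have -> : \sum_i ((s i, t i) == b)%:R = (if b.1 then if b.2 then (overlap s t)%:R
   else \sum_i ((s i, t i) == (true, false))%:R else if b.2 then
   \sum_i ((s i, t i) == (false, true))%:R
   else \sum_i ((s i, t i) == (false, false))%:R) :> R.
  by case: b => [] [] [] //=.
rewrite /dev !horner_bern.
move: (\sum_i ((s i, t i) == (true, false))%:R) => x.
move: (\sum_i ((s i, t i) == (false, true))%:R) => y.
move: (\sum_i ((s i, t i) == (false, false))%:R) => z.
move: (overlap s t)%:R (ones s)%:R (ones t)%:R n%:R n0' => o p q N N0.
have NV : N * N^-1 = 1 by rewrite divff.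
case: b => [] [] [] /= => E1 E2 E3 E4.
- by field.
- have -> : x = N * (p/N) - o by rewrite -E4; ring.
  by field.
- have -> : y = N * (q/N) - o by rewrite -E2; ring.
  by field.
- have -> : z = N * (1-p/N) - (N * (q/N) - o) by rewrite -E3 -E2; ring.
  by field.
Qed.

Lemma sum_sat1 I n k (s : valuation n) : (0 < n)%N ->
  \sum_(c : constraint n k) (sat_constraint I s c)%:R =
  n%:R ^+ k * (level R I k finset.set0).[(ones s)%:R / n%:R].
Proof.
move=> n0.
pose F (x : {ffun 'I_k -> bool}) : R := (I #|[set j | x j]|)%:R.
rewrite (eq_bigr (fun c : constraint n k => F [ffun j => s (c j)])); last first.
  move=> c _; congr ((I _)%:R); apply: eq_card => j; by rewrite !finset.inE ffunE.
rewrite (sum_comp_label _ _ _ s F) level0_horner mulr_sumr; apply: eq_bigr => x _.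
rewrite mulrCA; congr (_ * _).
under eq_bigr => j _ do rewrite count_label1 //.
by rewrite big_split /= prodr_const card_ord.
Qed.

(** By [count_label2] each position contributes a deviation term plus a product of Bernoulli
    weights. With [S] the positions where the deviation is chosen, the sum over pairs of patterns
    factors into a square because both weights agree. *)
Lemma sum_sat2 I n k (s t : valuation n) : (0 < n)%N -> ones s = ones t ->
  \sum_(c : constraint n k) (sat_constraint I s c && sat_constraint I t c)%:R =
  n%:R ^+ k * \sum_(S : {set 'I_k})
     (level R I k S).[(ones s)%:R / n%:R] ^+ 2 * (dev s t / n%:R) ^+ #|S|.
Proof.
move=> n0 est; set z := (ones s)%:R / n%:R.
pose F (x : {ffun 'I_k -> bool * bool}) : R :=
  (I #|[set j | (x j).1]|)%:R * (I #|[set j | (x j).2]|)%:R.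
rewrite (eq_bigr (fun c : constraint n k => F [ffun j => (s (c j), t (c j))])); last first.
  move=> c _; rewrite /F -natrM mulnb; congr ((I _ && I _)%:R); apply: eq_card => j;
    by rewrite !finset.inE ffunE.
rewrite (sum_comp_label _ _ _ (fun i => (s i, t i)) F) mulr_sumr.
under eq_bigr => x _ do
  (under eq_bigr => j _ do rewrite count_label2 //;
   rewrite big_split /= prodr_const card_ord -est -/z bigA_distr mulrCA !mulr_sumr).
rewrite exchange_big; apply: eq_bigr => S _ /=.
rewrite -mulr_sumr; congr (_ * _).
(* A pattern of pairs is split into a pair of patterns so that the double sum can factor. *)
rewrite (reindex (fun xy : {ffun 'I_k -> bool} * {ffun 'I_k -> bool} =>
    [ffun j => (xy.1 j, xy.2 j)])) /=; last first.
  exists (fun x => ([ffun j => (x j).1], [ffun j => (x j).2])) => [[x y] _|x _] /=.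
    by congr (_, _); apply/ffunP => j; rewrite !ffunE.
  by apply/ffunP => j; rewrite !ffunE; case: (x j).
pose a (x : {ffun 'I_k -> bool}) := (I #|[set j | x j]|)%:R *
  \prod_j (if j \in S then bsign R (x j) else (bern R (x j)).[z]).
have -> : (level R I k S).[z] = \sum_x a x.
  rewrite horner_sum; apply: eq_bigr => x _; rewrite hornerZ horner_prod; congr (_ * _).
  by apply: eq_bigr => j _; case: ifP; rewrite ?hornerC.
transitivity (\sum_(p : {ffun 'I_k -> bool} * {ffun 'I_k -> bool})
    a p.1 * a p.2 * (dev s t / n%:R) ^+ #|S|); last first.
  rewrite -(pair_bigA _ (fun x y => a x * a y * (dev s t / n%:R) ^+ #|S|)) /=.
  rewrite expr2 !mulr_suml; apply: eq_bigr => x _.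
  by rewrite mulr_sumr mulr_suml.
apply: eq_bigr => -[x y] _ /=.
have -> : (dev s t / n%:R) ^+ #|S| = \prod_j (if j \in S then dev s t / n%:R else 1) :> R.
  by rewrite -big_mkcond prodr_const.
rewrite /a /F -!mulrA; congr (_ * _).
  congr ((I _)%:R); apply: eq_card => j; by rewrite !finset.inE ffunE.
rewrite [RHS]mulrCA; congr (_ * _).
  congr ((I _)%:R); apply: eq_card => j; by rewrite !finset.inE ffunE.
rewrite -!big_split; apply: eq_bigr => j _; rewrite ffunE /=.
by case: ifP => _; ring.
Qed.

(** Independence of the [m] constraints, in counting form. *)
Lemma sum_prod_instance n k m (f : constraint n k -> R) :
  \sum_(F : instance n k m) \prod_l f (F l) = (\sum_c f c) ^+ m.
Proof. by rewrite -[in RHS](card_ord m) -prodr_const bigA_distr_bigA. Qed.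

Lemma card_instance n k m : #|{: instance n k m}|%:R = (n%:R ^+ k) ^+ m :> R.
Proof. by rewrite !card_ffun !card_ord !natrX. Qed.

Lemma sat_instanceE I n k m (s : valuation n) (F : instance n k m) :
  (sat_instance I s F)%:R = \prod_l (sat_constraint I s (F l))%:R :> R.
Proof.
rewrite /sat_instance; case: forallP => [H|/forallP].
  by rewrite big1 // => l _; rewrite H.
by rewrite negb_forall => /existsP[l Hl]; rewrite (bigD1 l) //= (negbTE Hl) mul0r.
Qed.

Lemma nsolE I n k m d (F : instance n k m) :
  (nsol I d F)%:R = \sum_(s in slice n d) (sat_instance I s F)%:R :> R.
Proof.
rewrite /nsol natr_card [RHS]big_mkcond; apply: eq_bigr => s _.
by rewrite finset.inE; case: eqP.
Qed.

Lemma EX_slice I n k m d : (0 < n)%N ->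
  EX I n k m d = #|slice n d|%:R * (level R I k finset.set0).[d%:R / n%:R] ^+ m :> R.
Proof.
move=> n0; have n0' : n%:R != 0 :> R by rewrite pnatr_eq0 -lt0n.
rewrite /EX card_instance; under eq_bigr => F _ do rewrite nsolE.
rewrite exchange_big (eq_bigr (fun=>
    (n%:R ^+ k * (level R I k finset.set0).[d%:R / n%:R]) ^+ m)) /=; last first.
  move=> s; rewrite finset.inE => /eqP <-; rewrite -sum_sat1 // -sum_prod_instance.
  by apply: eq_bigr => F _; rewrite sat_instanceE.
rewrite sumr_const -[_ *+ #|_|]mulr_natl exprMn.
have A0 : (n%:R ^+ k) ^+ m != 0 :> R by rewrite !expf_neq0.
by rewrite (mulrC ((n%:R ^+ k) ^+ m)) mulrA mulfK.
Qed.

Lemma EX2_slice I n k m d : (0 < n)%N ->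
  EX2 I n k m d = \sum_(s in slice n d) \sum_(t in slice n d)
    (\sum_(S : {set 'I_k})
       (level R I k S).[d%:R / n%:R] ^+ 2 * (dev s t / n%:R) ^+ #|S|) ^+ m :> R.
Proof.
move=> n0; have n0' : n%:R != 0 :> R by rewrite pnatr_eq0 -lt0n.
rewrite /EX2 card_instance.
under eq_bigr => F _ do rewrite nsolE expr2 mulr_suml.
rewrite exchange_big mulr_suml; apply: eq_bigr => s; rewrite finset.inE => /eqP sd /=.
under eq_bigr => F _ do rewrite mulr_sumr.
rewrite exchange_big mulr_suml; apply: eq_bigr => t; rewrite finset.inE => /eqP td /=.
apply: canLR (mulfK _) _; first by rewrite !expf_neq0.
rewrite -exprMn mulrC -sd -sum_sat2 ?td // -sum_prod_instance.
apply: eq_bigr => F _; rewrite !sat_instanceE -big_split; apply: eq_bigr => l _ /=.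
by rewrite -natrM mulnb.
Qed.

Lemma EX2_ge I n k m d : (0 < n)%N -> (EX I n k m d) ^+ 2 <= EX2 I n k m d :> R.
Proof.
move=> n0; rewrite /EX /EX2; set N := #|_|%:R.
pose f (F : instance n k m) : R := (nsol I d F)%:R.
have N0 : 0 < N by rewrite /N card_instance !exprn_gt0 // ltr0n.
rewrite -[X in (X / N) ^+ 2]/(\sum_F f F) -[X in _ <= X / N]/(\sum_F f F ^+ 2).
set e := _ / N.
have : 0 <= \sum_F (f F - e) ^+ 2 by apply: sumr_ge0 => F _; apply: sqr_ge0.
have -> : \sum_F (f F - e) ^+ 2 = \sum_F (f F) ^+ 2 - e ^+ 2 * N.
  under eq_bigr => F _ do rewrite sqrrB.
  rewrite big_split sumrB /= sumr_const -[_ *+ #|_|]mulr_natr -/N sumrMnl -mulr_suml.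
  have -> : \sum_i f i = e * N by rewrite /e divfK // gt_eqF.
  by ring.
by rewrite subr_ge0 -ler_pdivlMr.
Qed.

End MomentFormulas.

(** * Averages over pairs of valuations of the same weight *)

Section Averages.
Variable R : realType.

(** * Exchanges of two positions in a valuation *)

Definition swap {n} (i j : 'I_n) (t : valuation n) : valuation n :=
  [ffun l => t (tperm i j l)].

Lemma swapK n (i j : 'I_n) : involutive (swap i j).
Proof. by move=> t; apply/ffunP => l; rewrite !ffunE tpermK. Qed.

Lemma ones_swap n (i j : 'I_n) t : ones (swap i j t) = ones t.
Proof.
rewrite /ones -(card_imset _ (@perm_inj _ (tperm i j))); apply: eq_card => l.
apply/imsetP/idP => [[a]|]; rewrite !finset.inE ?ffunE.
  by move=> xa ->.
by move=> xl; exists (tperm i j l); rewrite ?finset.inE ?ffunE tpermK.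
Qed.

Lemma dev_swap n (i j : 'I_n) (s t : valuation n) :
  s i -> ~~ s j -> t i -> ~~ t j -> dev R s (swap i j t) = dev R s t - 1.
Proof.
move=> si sj ti tj; rewrite /dev ones_swap.
suff -> : (overlap s (swap i j t))%:R = (overlap s t)%:R - 1 :> R by rewrite addrAC.
have ij : i != j by apply: contraNneq sj => <-.
rewrite !natr_card (bigD1 i) // [in RHS](bigD1 i) //= ffunE tpermL si ti (negbTE tj) /=.
rewrite add0r addrAC subrr add0r; apply: eq_bigr => l li; rewrite ffunE.
have [->|lj] := eqVneq l j; first by rewrite (negbTE sj).
by rewrite tpermD // eq_sym.
Qed.

Lemma slice_counts n d (s t : valuation n) : s \in slice n d -> t \in slice n d ->
  [/\ \sum_i (s i && t i)%:R = (overlap s t)%:R :> R,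
      \sum_i (s i && ~~ t i)%:R = d%:R - (overlap s t)%:R :> R,
      \sum_i (~~ s i && t i)%:R = d%:R - (overlap s t)%:R :> R &
      \sum_i (~~ s i && ~~ t i)%:R = n%:R - d%:R *+ 2 + (overlap s t)%:R :> R].
Proof.
rewrite !finset.inE => /eqP sd /eqP td.
have es : \sum_i (s i)%:R = d%:R :> R by rewrite -natr_card -sd.
have et : \sum_i (t i)%:R = d%:R :> R by rewrite -natr_card -td.
have en : \sum_(i < n) 1 = n%:R :> R by rewrite sumr_const card_ord.
rewrite natr_card -es; split=> //.
- by rewrite -sumrB; apply: eq_bigr => i _; case: (s i); case: (t i) => /=; lra.
- rewrite es -et -sumrB; apply: eq_bigr => i _; case: (s i); case: (t i) => /=; lra.
- rewrite mulr2n {2}es -et -en -big_split /= -sumrB -big_split /=.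
  by apply: eq_bigr => i _; case: (s i); case: (t i) => /=; lra.
Qed.

(* Detailed balance for the chain that exchanges a one and a zero of [t]. *)
Lemma slice_balance n d (s : valuation n) (phi : R -> R) : s \in slice n d ->
  \sum_(t in slice n d) (d%:R - (overlap s t)%:R) ^+ 2 * phi (dev R s t)
  = \sum_(t in slice n d) (overlap s t)%:R * (n%:R - d%:R *+ 2 + (overlap s t)%:R)
       * phi (dev R s t - 1).
Proof.
move=> sD.
(* The square counts the pairs of a position [i] that is a one of [s] only and a position [j] that
   is a one of [t] only. Exchanging them in [t] makes [i] a common one and [j] a common zero, which
   is what the right-hand factors count. *)
transitivity (\sum_i \sum_j \sum_(t in slice n d)
    (s i && ~~ t i)%:R * (~~ s j && t j)%:R * phi (dev R s t)).
  under [RHS]eq_bigr => i _ do rewrite exchange_big.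
  rewrite exchange_big; apply: eq_bigr => t tD /=.
  have [_ e1 e2 _] := slice_counts _ _ _ _ sD tD.
  rewrite expr2 -{1}e1 -e2 !mulr_suml; apply: eq_bigr => i _.
  by rewrite mulr_sumr mulr_suml.
transitivity (\sum_i \sum_j \sum_(t in slice n d)
    (s i && t i)%:R * (~~ s j && ~~ t j)%:R * phi (dev R s t - 1)); last first.
  under eq_bigr => i _ do rewrite exchange_big.
  rewrite exchange_big; apply: eq_bigr => t tD /=.
  have [e1 _ _ e2] := slice_counts _ _ _ _ sD tD.
  rewrite -e2 -e1 !mulr_suml; apply: eq_bigr => i _.
  by rewrite mulr_sumr mulr_suml.
apply: eq_bigr => i _; apply: eq_bigr => j _.
rewrite (reindex_inj (inv_inj (swapK _ i j))).
apply: eq_big => t; first by rewrite !finset.inE ones_swap.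
move=> _; rewrite !ffunE tpermL tpermR.
have [/and4P[si sj ti tj]|H] := boolP [&& s i, ~~ s j, t i & ~~ t j].
  by rewrite dev_swap // si sj ti tj.
by move: H; case: (s i); case: (s j); case: (t i); case: (t j) => //= _;
  rewrite ?mul0r ?mulr0 ?mul0r.
Qed.

Definition avg (n d : nat) (F : R -> R) : R :=
  (\sum_(s in slice n d) \sum_(t in slice n d) F (dev R s t)) / #|slice n d|%:R ^+ 2.

Lemma slice_gt0 n d : (d <= n)%N -> (0 < #|slice n d|)%N.
Proof.
move=> dn; apply/card_gt0P; exists [ffun i : 'I_n => (i < d)%N].
rewrite finset.inE /ones cardsE -sum1_card (eq_bigl (fun i : 'I_n => (i < d)%N)).
  by rewrite -(big_ord_widen _ (fun=> 1%N)) // sum1_card card_ord.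
by move=> i; rewrite [LHS]ffunE.
Qed.

Lemma avg_cst n d c : (d <= n)%N -> avg n d (fun=> c) = c.
Proof.
move=> dn; rewrite /avg !sumr_const -mulrnA -[_ *+ _]mulr_natr natrM -expr2 mulfK //.
by rewrite expf_neq0 // pnatr_eq0 -lt0n slice_gt0.
Qed.

Lemma avgD n d F G : avg n d (fun y => F y + G y) = avg n d F + avg n d G.
Proof. by rewrite /avg -mulrDl -big_split /=; under [in RHS]eq_bigr do rewrite -big_split. Qed.

Lemma avgZ n d c F : avg n d (fun y => c * F y) = c * avg n d F.
Proof.
rewrite /avg mulrA mulr_sumr; congr (_ / _); apply: eq_bigr => s _.
by rewrite mulr_sumr.
Qed.

Lemma avg_sum n d (J : Type) (r : seq J) (F : J -> R -> R) :
  avg n d (fun y => \sum_(j <- r) F j y) = \sum_(j <- r) avg n d (F j).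
Proof.
elim: r => [|j r IH]; last first.
  by rewrite big_cons -IH -avgD; congr avg; apply/funext => y; rewrite big_cons.
rewrite big_nil /avg big1 ?mul0r // => s _; rewrite big1 // => t _; by rewrite big_nil.
Qed.

Lemma dev_slice n d (s t : valuation n) : s \in slice n d -> t \in slice n d ->
  dev R s t = (overlap s t)%:R - d%:R ^+ 2 / n%:R.
Proof. by rewrite !finset.inE /dev expr2 => /eqP -> /eqP ->. Qed.

Lemma overlap_le n (s t : valuation n) : (overlap s t <= ones s)%N.
Proof.
by apply: subset_leq_card; apply/fintype.subsetP => i; rewrite !finset.inE => /andP[].
Qed.

Lemma dev_le n d (s t : valuation n) : (0 < n)%N -> (d <= n)%N ->
  s \in slice n d -> t \in slice n d -> `|dev R s t| <= n%:R.
Proof.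
move=> n0 dn sD tD; rewrite (dev_slice _ _ _ _ sD tD).
have n0' : 0 < n%:R :> R by rewrite ltr0n.
have := overlap_le _ s t; rewrite finset.inE in sD; rewrite (eqP sD) => od.
have : (overlap s t)%:R <= n%:R :> R by rewrite ler_nat (leq_trans od).
have : 0 <= (overlap s t)%:R :> R by [].
have dn' : d%:R <= n%:R :> R by rewrite ler_nat.
have : 0 <= d%:R ^+ 2 / n%:R :> R by rewrite divr_ge0 // sqr_ge0.
have : d%:R ^+ 2 / n%:R <= n%:R :> R.
  by rewrite ler_pdivrMr // expr2 ler_pM.
rewrite ler_norml => *; apply/andP; split; lra.
Qed.

(** This rate and the next count the exchanges that raise, respectively lower, the overlap by one,
    as polynomials in the deviation [y]. *)
Definition up_rate (n d : nat) (y : R) : R :=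
  (d%:R - d%:R ^+ 2 / n%:R - y) ^+ 2.
Definition down_rate (n d : nat) (y : R) : R :=
  (d%:R ^+ 2 / n%:R + y) * ((n%:R - d%:R) ^+ 2 / n%:R + y).

Lemma up_rateE n d (s t : valuation n) : s \in slice n d -> t \in slice n d ->
  up_rate n d (dev R s t) = (d%:R - (overlap s t)%:R) ^+ 2.
Proof.
by move=> sD tD; rewrite /up_rate (dev_slice _ _ _ _ sD tD); congr (_ ^+ 2); ring.
Qed.

Lemma down_rateE n d (s t : valuation n) :
  (0 < n)%N -> s \in slice n d -> t \in slice n d ->
  down_rate n d (dev R s t) =
  (overlap s t)%:R * (n%:R - d%:R *+ 2 + (overlap s t)%:R).
Proof.
move=> n0 sD tD; have n0' : n%:R != 0 :> R by rewrite pnatr_eq0 -lt0n.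
by rewrite /down_rate (dev_slice _ _ _ _ sD tD); field.
Qed.

(** The comparison is only required at values of [y] that may occur for a pair; there each rate is a
    product of two cardinals of sets of positions. *)
Lemma avg_le_rate n d F G : (0 < n)%N -> (d <= n)%N ->
  (forall y, `|y| <= n%:R -> 0 <= up_rate n d y <= n%:R ^+ 2 ->
     0 <= down_rate n d y <= n%:R ^+ 2 -> F y <= G y) ->
  avg n d F <= avg n d G.
Proof.
move=> n0 dn FG; rewrite /avg ler_wpM2r ?invr_ge0 ?sqr_ge0 //.
apply: ler_sum => s sD; apply: ler_sum => t tD; apply: FG.
- exact: dev_le tD.
- rewrite sqr_ge0 up_rateE //.
  have [_ <- _ _] := slice_counts _ _ _ _ sD tD.
  by rewrite -natr_card lerXn2r ?nnegrE ?ler0n // ler_nat -[leqRHS]card_ord max_card.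
- rewrite down_rateE //.
  have [<- _ _ <-] := slice_counts _ _ _ _ sD tD.
  rewrite -!natr_card mulr_ge0 ?ler0n //= expr2 ler_pM ?ler0n //.
    by rewrite ler_nat -[leqRHS]card_ord max_card.
  by rewrite ler_nat -[leqRHS]card_ord max_card.
Qed.

Lemma avg_le n d F G : (0 < n)%N -> (d <= n)%N ->
  (forall y, `|y| <= n%:R -> F y <= G y) -> avg n d F <= avg n d G.
Proof. by move=> n0 dn FG; apply: avg_le_rate => // y ? _ _; apply: FG. Qed.

Lemma avg_norm n d F : (0 < n)%N -> (d <= n)%N ->
  `|avg n d F| <= avg n d (fun y => `|F y|).
Proof.
move=> n0 dn; rewrite ler_norml -mulN1r -avgZ; apply/andP; split; apply: avg_le => // y _.
  by rewrite mulN1r lerNl -normrN ler_norm.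
exact: ler_norm.
Qed.

Lemma avg_balance n d (phi : R -> R) : (0 < n)%N ->
  avg n d (fun y => up_rate n d y * phi y)
  = avg n d (fun y => down_rate n d y * phi (y - 1)).
Proof.
move=> n0; rewrite /avg; congr (_ / _); apply: eq_bigr => s sD.
under eq_bigr => t tD do rewrite up_rateE //.
by rewrite slice_balance //; apply: eq_bigr => t tD; rewrite down_rateE.
Qed.

(** The quadratic terms cancel: the chain has an exactly linear drift towards [y = 0]. *)
Lemma up_down n d y : (0 < n)%N -> up_rate n d y - down_rate n d y = - (n%:R * y).
Proof.
move=> n0; have n0' : n%:R != 0 :> R by rewrite pnatr_eq0 -lt0n.
rewrite /up_rate /down_rate; by field.
Qed.

(** A discrete integration by parts: detailed balance, with [up_rate] eliminated through the linear
    drift. *)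
Lemma avg_stein n d (phi : R -> R) : (0 < n)%N ->
  n%:R * avg n d (fun y => y * phi y)
  = avg n d (fun y => down_rate n d y * (phi y - phi (y - 1))).
Proof.
move=> n0; have H := avg_balance n d phi n0.
apply: (addrI (avg n d (fun y => up_rate n d y * phi y))).
rewrite {2}H -avgZ -!avgD; congr avg; apply/funext => y.
have -> : up_rate n d y = down_rate n d y - n%:R * y by rewrite -(up_down n d y n0); ring.
by ring.
Qed.

(** Here [expR x] is at most the inverse of [1 - x], and [(1 + x + 2 * x ^+ 2) * (1 - x)] exceeds 1
    by [x ^+ 2 * (1 - 2 * x)]. *)
Lemma expR_le_quad (x : R) : `|x| <= 1 / 2 -> expR x <= 1 + x + 2 * x ^+ 2.
Proof.
rewrite ler_norml => /andP[x1 x2].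
have x0 : 0 < 1 - x by lra.
have H : 1 - x <= expR (- x) by rewrite expR_ge1Dx.
rewrite -[x in expR x]opprK expRN; apply: (@le_trans _ _ (1 - x)^-1).
  by rewrite lef_pV2 // posrE // expR_gt0.
rewrite -[_^-1]mul1r ler_pdivrMr //.
have : 0 <= x ^+ 2 * (1 - 2 * x) by rewrite mulr_ge0 ?sqr_ge0 //; lra.
by lra.
Qed.

Lemma expR_ge_Xfact (x : R) j : 0 <= x -> x ^+ j / j`!%:R <= expR x.
Proof.
move=> x0; case: j => [|j].
  by rewrite expr0 divr1 -expR0 ler_expR.
by apply: le_trans (expR_ge1Dxn j x0); rewrite lerDr.
Qed.

(* The Lyapunov function of the exchange chain is [exp (y^2 / 32n)]. *)
Lemma avg_expR n d : (0 < n)%N -> (d <= n)%N ->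
  avg n d (fun y => expR (y ^+ 2 / (32 * n%:R))) <= 2 * expR (1 / 4).
Proof.
move=> n0 dn; set N : R := n%:R.
have N0 : 0 < N by rewrite ltr0n.
have N1 : 1 <= N by rewrite ler1n.
pose f y : R := expR (y ^+ 2 / (32 * N)).
have f0 y : 0 < f y by apply: expR_gt0.
(* By balance the generator of the chain applied to [f] has average 0; the integrand here bounds it
   from above. *)
have drift : 0 <= avg n d (fun y => f y * (N / 8 - y ^+ 2 / 32)).
  have := avg_balance n d (fun y => f (y + 1) - f y) n0.
  move=> /eqP; rewrite -subr_eq0 => /eqP; rewrite -[X in _ + X]mulN1r -avgZ -avgD => <-.
  apply: avg_le_rate => // y yn.
  move=> /andP[u0 un] /andP[w0 wn]; rewrite -/N in yn un wn.
  rewrite subrK.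
  have ud : up_rate n d y - down_rate n d y = - (N * y) by exact: up_down.
  have step (e : R) : `|e| <= 1 -> f (y + e) - f y <=
      f y * ((2 * e * y + e ^+ 2) / (32 * N) + 2 * ((2 * e * y + e ^+ 2) / (32 * N)) ^+ 2).
    move=> e1.
    have -> : f (y + e) = f y * expR ((2 * e * y + e ^+ 2) / (32 * N)).
      rewrite -expRD; congr expR; field; exact: lt0r_neq0.
    have : expR ((2 * e * y + e ^+ 2) / (32 * N)) <=
      1 + (2 * e * y + e ^+ 2) / (32 * N) + 2 * ((2 * e * y + e ^+ 2) / (32 * N)) ^+ 2.
      apply: expR_le_quad; rewrite normrM normfV (gtr0_norm (_ : 0 < 32 * N)); last lra.
      rewrite ler_pdivrMr; last lra.
      apply: (le_trans (ler_normD _ _)); rewrite normrX !normrM (ger0_norm (_ : 0 <= 2)) //.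
      have : `|e| * `|y| <= 1 * N by rewrite ler_pM.
      have : `|e| ^+ 2 <= 1 by rewrite expr_le1.
      by lra.
    by rewrite -(ler_pM2l (f0 y)); lra.
  have s1 := step 1 _; have s2 := step (-1) _.
  move: s1 s2; rewrite normrN normr1 => /(_ (lexx _)) s1 /(_ (lexx _)) s2.
  move: u0 un w0 wn ud; set u := up_rate _ _ _; set w := down_rate _ _ _ => u0 un w0 wn ud.
  have k1 := ler_wpM2l u0 s1; have k2 := ler_wpM2l w0 s2.
  have : f y * (u * ((2 * 1 * y + 1 ^+ 2) / (32 * N) + 2 * ((2 * 1 * y + 1 ^+ 2) / (32 * N)) ^+ 2)
     + w * ((2 * -1 * y + (-1) ^+ 2) / (32 * N) + 2 * ((2 * -1 * y + (-1) ^+ 2) / (32 * N)) ^+ 2))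
     <= f y * (N / 8 - y ^+ 2 / 32).
    rewrite ler_wpM2l ?ltW //.
    have b1 : (u + w) / (32 * N) <= N / 16.
      rewrite ler_pdivrMr; last lra.
      have -> : N / 16 * (32 * N) = 2 * N ^+ 2 by field.
      by lra.
    have b2 (a b : R) : 0 <= a -> a <= N ^+ 2 -> 2 * (a * (b / (32 * N)) ^+ 2) <= b ^+ 2 / 512.
      move=> a0 aN; have : a * (b / (32 * N)) ^+ 2 <= N ^+ 2 * (b / (32 * N)) ^+ 2.
        by rewrite ler_wpM2r // sqr_ge0.
      have -> : N ^+ 2 * (b / (32 * N)) ^+ 2 = b ^+ 2 / 1024 by field; exact: lt0r_neq0.
      by lra.
    have b3 := b2 u (2 * 1 * y + 1 ^+ 2) u0 un.
    have b4 := b2 w (2 * -1 * y + (-1) ^+ 2) w0 wn.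
    (* The linear drift supplies the negative term; the squared increments, summed in [b3] and [b4],
       give back at most [y ^+ 2 / 64 + 1 / 256]. *)
    have b5 : (2 * y) * (u - w) / (32 * N) = - (y ^+ 2 / 16).
      by rewrite ud; field; exact: lt0r_neq0.
    have e1 : u * ((2 * 1 * y + 1 ^+ 2) / (32 * N)) + w * ((2 * -1 * y + (-1) ^+ 2) / (32 * N))
       = (2 * y) * (u - w) / (32 * N) + (u + w) / (32 * N) by ring.
    have e2 : (2 * 1 * y + 1 ^+ 2) ^+ 2 + (2 * -1 * y + (-1) ^+ 2) ^+ 2 = 8 * y ^+ 2 + 2 by ring.
    have y2 := sqr_ge0 y.
    rewrite !mulrDr.
    by lra.
  by rewrite /=; lra.
(* Split at [y ^+ 2 = 8 * N]: below it [f] is at most [expR (1 / 4)], above it the factor of [f] is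
   at most [- (N / 8)]. *)
have cap : avg n d (fun y => f y * (N / 8 - y ^+ 2 / 32)) <=
    avg n d (fun y => N / 4 * expR (1 / 4) + (- (N / 8)) * f y).
  apply: avg_le => // y _; have fy := f0 y.
  have [y8|y8] := lerP (y ^+ 2) (8 * N).
    have : f y <= expR (1 / 4).
      rewrite ler_expR ler_pdivrMr; last lra.
      by lra.
    rewrite -(ler_pM2l N0) => H.
    have : 0 <= f y * y ^+ 2 by rewrite mulr_ge0 ?sqr_ge0 // ltW.
    by lra.
  have : 0 <= N * expR (1 / 4) by rewrite mulr_ge0 ?expR_ge0 ?ltW.
  have : f y * (8 * N) <= f y * y ^+ 2 by rewrite ler_pM2l ?ltW.
  by lra.
have := le_trans drift cap.
rewrite avgD avg_cst // avgZ -/(avg n d f) -[avg n d (fun=> _)]/(avg n d f) => H.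
rewrite -(ler_pM2l (_ : 0 < N / 8)); last by rewrite divr_gt0.
by lra.
Qed.

Definition avg_bound : R := expR (1 / 32) * (2 * expR (1 / 4)).

(** Apply [x ^+ j / j! <= expR x] to [x = (1 + y ^+ 2 / n) / 32]. The growth in [j!] is what a
    binomial coefficient will later absorb. *)
Lemma avg_pow n d j : (0 < n)%N -> (d <= n)%N ->
  avg n d (fun y => (1 + y ^+ 2 / n%:R) ^+ j) <= 32 ^+ j * j`!%:R * avg_bound.
Proof.
move=> n0 dn; have N0 : 0 < n%:R :> R by rewrite ltr0n.
apply: (@le_trans _ _ (avg n d (fun y =>
   32 ^+ j * j`!%:R * expR (1 / 32) * expR (y ^+ 2 / (32 * n%:R))))); last first.
  rewrite avgZ /avg_bound -!mulrA !ler_wpM2l ?exprn_ge0 ?ler0n ?expR_ge0 //.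
  exact: avg_expR.
apply: avg_le => // y _; rewrite -mulrA -expRD.
have -> : 1 / 32 + y ^+ 2 / (32 * n%:R) = (1 + y ^+ 2 / n%:R) / 32 :> R.
  by field; exact: lt0r_neq0.
have p0 : 0 <= 1 + y ^+ 2 / n%:R by rewrite addr_ge0 // divr_ge0 ?sqr_ge0 // ltW.
have := expR_ge_Xfact ((1 + y ^+ 2 / n%:R) / 32) j (divr_ge0 p0 (ler0n _ _)).
have F0 : 0 < j`!%:R :> R by rewrite ltr0n fact_gt0.
rewrite ler_pdivrMr // expr_div_n ler_pdivrMr ?exprn_gt0 //.
rewrite (_ : 32 ^+ j * j`!%:R * _ =
  expR ((1 + y ^+ 2 / n%:R) / 32) * j`!%:R * 32 ^+ j) //.
by ring.
Qed.

End Averages.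

Local Open Scope classical_set_scope.

(** * Limits of moments *)

Section Convergence.
Variable R : realType.
Implicit Types (u v : nat -> R) (p q : nat -> {poly R}).

Lemma is_cvgn_cst (c : R) : cvgn (fun _ : nat => c).
Proof. exact: is_cvg_cst. Qed.

Lemma is_cvgn_add u v : cvgn u -> cvgn v -> cvgn (fun n => u n + v n).
Proof. exact: is_cvgD. Qed.

Lemma is_cvgn_mul u v : cvgn u -> cvgn v -> cvgn (fun n => u n * v n).
Proof. exact: is_cvgM. Qed.

Lemma is_cvgn_sum (J : Type) (r : seq J) (u : J -> nat -> R) :
  (forall j, cvgn (u j)) -> cvgn (fun n => \sum_(j <- r) u j n).
Proof.
move=> H; elim: r => [|j r IH].
  by under eq_fun do rewrite big_nil; apply: is_cvgn_cst.
by under eq_fun do rewrite big_cons; apply: is_cvgn_add.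
Qed.

Lemma is_cvgn_exp u j : cvgn u -> cvgn (fun n => u n ^+ j).
Proof.
move=> cu; elim: j => [|j IH]; first exact: is_cvgn_cst.
by under eq_fun do rewrite exprS; apply: is_cvgn_mul.
Qed.

Lemma is_cvgn_near u v : (\forall n \near \oo, u n = v n) -> cvgn u -> cvgn v.
Proof.
move=> uv /cvg_ex[l ul]; apply/cvg_ex; exists l.
by apply: cvg_trans ul; apply: near_eq_cvg.
Qed.

Lemma cvgn_bounded_mul0 u v (K : R) : u @ \oo --> (0 : R) ->
  (\forall n \near \oo, `|v n| <= K) -> (fun n => u n * v n) @ \oo --> (0 : R).
Proof.
move=> u0 vK; apply/norm_cvg0P.
have H : (fun n => `|u n| * K) @ \oo --> (0 : R).
  rewrite -[X in _ --> X](mul0r K); apply: cvgM; last exact: cvg_cst.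
  by apply/norm_cvg0P.
apply: (squeeze_cvgr _ (cvg_cst 0) H); near=> n.
rewrite normr_ge0 normrM ler_wpM2l //; near: n; exact: vK.
Unshelve. all: by end_near. Qed.

Definition coefcvg p := forall i, cvgn (fun n => (p n)`_i).

Lemma coefcvg_cst (r : {poly R}) : coefcvg (fun=> r).
Proof. by move=> i; apply: is_cvgn_cst. Qed.

Lemma coefcvgC u : cvgn u -> coefcvg (fun n => (u n)%:P).
Proof.
move=> cu i; under eq_fun do rewrite coefC.
by case: (i == 0%N); [|apply: is_cvgn_cst].
Qed.

Lemma coefcvgD p q : coefcvg p -> coefcvg q -> coefcvg (fun n => p n + q n).
Proof. by move=> cp cq i; under eq_fun do rewrite coefD; apply: is_cvgn_add. Qed.

Lemma coefcvgM p q : coefcvg p -> coefcvg q -> coefcvg (fun n => p n * q n).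
Proof.
move=> cp cq i; under eq_fun do rewrite coefM.
by apply: is_cvgn_sum => j; apply: is_cvgn_mul.
Qed.

Lemma coefcvgX p j : coefcvg p -> coefcvg (fun n => p n ^+ j).
Proof.
move=> cp; elim: j => [|j IH]; first exact: coefcvg_cst.
by under eq_fun do rewrite exprS; apply: coefcvgM.
Qed.

Lemma coefcvg_sum (J : Type) (r : seq J) (p : J -> nat -> {poly R}) :
  (forall j, coefcvg (p j)) -> coefcvg (fun n => \sum_(j <- r) p j n).
Proof.
by move=> H i; under eq_fun do rewrite coef_sum; apply: is_cvgn_sum => j; apply: H.
Qed.

(** Dominated convergence for sums of growing length: cutting at [J] costs at most [2 * B / 2 ^+ J],
    uniformly for large [n], and each cut sum converges. *)
Lemma tannery (m : nat -> nat) (t : nat -> nat -> R) (B : R) :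
  (forall j, cvgn (t j)) -> (forall j n, (m n < j)%N -> t j n = 0) ->
  (\forall n \near \oo, forall j, `|t j n| <= B / 2 ^+ j) ->
  cvgn (fun n => \sum_(j < (m n).+1) t j n).
Proof.
move=> ct t0 tB.
pose S n := \sum_(j < (m n).+1) t j n.
have trunc J n : (forall j, `|t j n| <= B / 2 ^+ j) ->
    `|S n - \sum_(j < J) t j n| <= 2 * B / 2 ^+ J.
  move=> Hn.
  have B0 : 0 <= B by have := Hn 0%N; rewrite expr0 divr1; apply: le_trans.
  have rem a b : (a <= b)%N ->
      `|\sum_(j < b) t j n - \sum_(j < a) t j n| <= 2 * B / 2 ^+ a - 2 * B / 2 ^+ b.
    elim: b => [|b IH] ab.
      by move: ab; rewrite leqn0 => /eqP ->; rewrite !subrr normr0.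
    move: ab; rewrite leq_eqVlt ltnS => /predU1P[->|/IH H]; first by rewrite !subrr normr0.
    rewrite big_ord_recr /= addrAC; apply: le_trans (ler_normD _ _) _.
    apply: le_trans (lerD H (Hn b)) _.
    have -> : 2 * B / 2 ^+ b.+1 = B / 2 ^+ b.
      by rewrite exprS -mulf_div divff ?mul1r // pnatr_eq0.
    have -> : 2 * B / 2 ^+ b = 2 * (B / 2 ^+ b) by rewrite mulrA.
    by lra.
  have pos a : 0 <= 2 * B / 2 ^+ a by rewrite divr_ge0 ?exprn_ge0 // mulr_ge0.
  have [Jm|mJ] := leqP J (m n).+1.
    by apply: le_trans (rem _ _ Jm) _; have := pos (m n).+1; lra.
  have -> : \sum_(j < J) t j n = S n.
    rewrite /S (big_ord_widen_cond _ xpredT (fun j => t j n) (ltnW mJ)) /=.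
    rewrite [RHS]big_mkcond; apply: eq_bigr => j _.
    by case: ltnP => // jm; apply: t0.
  by rewrite subrr normr0.
apply/cauchy_cvgP/cauchy_exP => /= e e0.
have [J HJ] : exists J, 2 * B / 2 ^+ J < e / 3.
  have H : (fun J => (2 * B) * (1 / 2) ^+ J) @ \oo --> (0 : R).
    rewrite -[X in _ --> X](mulr0 (2 * B)); apply: cvgM; first exact: cvg_cst.
    by apply: cvg_expr; rewrite ger0_norm //; lra.
  move/cvgr0Pnorm_lt : H => /(_ (e / 3)) [|J _ HJ]; first by rewrite divr_gt0.
  exists J; have := HJ J (leqnn J); rewrite expr_div_n expr1n mul1r.
  by apply: le_lt_trans; apply: ler_norm.
have /cvg_ex[l Hl] : cvgn (fun n => \sum_(j < J) t j n) by exact: is_cvgn_sum.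
have /cvgrPdist_lt/(_ (e / 3)) Hl' := Hl.
(* The limit [l] of the cut sum is not the limit sought; it only serves as centre of a ball of
   radius [e] for the Cauchy criterion. *)
exists l; rewrite /fmap /=.
have e3 : 0 < e / 3 by rewrite divr_gt0.
near=> n; rewrite -ball_normE /ball_ /=.
have h1 : `|S n - \sum_(j < J) t j n| <= 2 * B / 2 ^+ J.
  by apply: trunc; near: n.
have h2 : `|l - \sum_(j < J) t j n| < e / 3 by near: n; apply: Hl'.
have -> : l - \sum_(j < (m n).+1) t j n
   = (l - \sum_(j < J) t j n) - (S n - \sum_(j < J) t j n) by rewrite /S; ring.
apply: le_lt_trans (ler_normB _ _) _; lra.
Unshelve. all: by end_near. Qed.

Variables (d : nat -> nat) (delta : R).
Hypothesis d_le : forall n, (d n <= n)%N.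
Hypothesis d_cvg : (fun n => (d n)%:R / n%:R) @ \oo --> delta.

(** * Moments of the normalised deviation [y / sqrt n] *)

Definition scale (n : nat) : R := (Num.sqrt n%:R)^-1.

Lemma scale_gt0 n : (0 < n)%N -> 0 < scale n.
Proof. by move=> n0; rewrite invr_gt0 sqrtr_gt0 ltr0n. Qed.

Lemma scale_sqr n : (0 < n)%N -> scale n ^+ 2 = n%:R^-1.
Proof. by move=> n0; rewrite exprVn sqr_sqrtr. Qed.

Lemma scale_cvg0 : scale @ \oo --> (0 : R).
Proof.
apply/cvgr0Pnorm_lt => e e0.
have /cvgr0Pnorm_lt/(_ _ (exprn_gt0 2 e0)) [M _ HM] := @cvg_harmonic R.
exists M.+1 => // -[|n] //= Mn.
have := HM n Mn; rewrite /= ger0_norm ?invr_ge0 // -scale_sqr // => H.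
rewrite ger0_norm; last exact/ltW/scale_gt0.
by rewrite -(@ltr_pXn2r _ 2) // nnegrE ltW // scale_gt0.
Qed.

Definition moment s n : R := avg R n (d n) (fun y => (y * scale n) ^+ s).

Lemma moment_le s n : (0 < n)%N -> `|moment s n| <= 32 ^+ s * s`!%:R * avg_bound R.
Proof.
move=> n0; apply: le_trans (avg_norm _ _ _ _ n0 (d_le n)) _.
apply: le_trans (avg_pow _ _ _ _ n0 (d_le n)); apply: avg_le => // y _.
have N0 : 0 < n%:R :> R by rewrite ltr0n.
rewrite normrX lerXn2r ?nnegrE //; first by rewrite addr_ge0 // divr_ge0 ?sqr_ge0.
have -> : y ^+ 2 / n%:R = `|y * scale n| ^+ 2 by rewrite real_normK ?num_real // exprMn scale_sqr.
by move: `|_| => z; have := sqr_ge0 (z - 1 / 2); lra.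
Qed.

Lemma avg_polyE (p : {poly R}) N n : (size p <= N)%N ->
  avg R n (d n) (fun y => p.[y * scale n]) = \sum_(i < N) p`_i * moment i n.
Proof.
move=> sp; under eq_fun do rewrite (horner_coef_wide _ sp).
by rewrite avg_sum; apply: eq_bigr => i _; rewrite avgZ.
Qed.

Lemma avg_poly_cvg p N : (forall n, size (p n) <= N)%N -> coefcvg p ->
  (forall i, (i < N)%N -> cvgn (moment i)) ->
  cvgn (fun n => avg R n (d n) (fun y => (p n).[y * scale n])).
Proof.
move=> sp cp cm; under eq_fun => n do rewrite (avg_polyE _ _ _ (sp n)).
by apply: is_cvgn_sum => i; apply: is_cvgn_mul; [apply: cp|apply: cm].
Qed.

(** The difference quotient of ['X^s] with step [h], expanded so that it makes sense without
    dividing by [h]. *)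
Definition stein_quot s (h : R) : {poly R} :=
  \sum_(i < s) 'X^(s.-1 - i) * ('X - h%:P) ^+ i.

Lemma size_stein_quot s h : (size (stein_quot s h) <= s)%N.
Proof.
apply: (leq_trans (size_sum _ _ _)); apply/bigmax_leqP => i _.
apply: (leq_trans (size_polyMleq _ _)).
rewrite size_polyXn size_exp_XsubC addnS /=.
case: s i => [[]//|s i] /=; rewrite addSn subnK // -ltnS.
exact: ltn_ord.
Qed.

(** This is [avg_stein] for [(y * scale n) ^+ s]. Multiplied by [scale n ^+ 3], its left side
    becomes the moment of order [s.+1], and each factor of [down_rate] is divided by [n]. *)
Lemma stein_moment s n : (0 < n)%N ->
  moment s.+1 n = avg R n (d n) (fun y =>
   (((d n)%:R / n%:R) ^+ 2 + scale n * (y * scale n)) *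
   ((1 - (d n)%:R / n%:R) ^+ 2 + scale n * (y * scale n)) *
   (stein_quot s (scale n)).[y * scale n]).
Proof.
move=> n0; set h := scale n; have h0 : 0 < h := scale_gt0 _ n0.
have hn : n%:R = (h ^+ 2)^-1 by rewrite scale_sqr // invrK.
have := avg_stein _ _ (d n) (fun y => (y * h) ^+ s) n0.
move/(congr1 (fun x => h ^+ 3 * x)); rewrite mulrA -!avgZ => H.
transitivity (avg R n (d n) (fun y => h ^+ 3 * n%:R * (y * (y * h) ^+ s))).
  rewrite /moment; congr avg; apply/funext => y; rewrite hn exprS -/h.
  by field; exact: lt0r_neq0.
rewrite H; congr avg; apply/funext => y; rewrite subrXX.
have -> : \sum_(i < s) (y * h) ^+ (s.-1 - i) * ((y - 1) * h) ^+ i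
   = (stein_quot s h).[y * h].
  rewrite horner_sum; apply: eq_bigr => i _.
  rewrite hornerM hornerXn horner_exp hornerXsubC; congr (_ * _ ^+ _); ring.
rewrite /down_rate hn; field; exact: lt0r_neq0.
Qed.

Lemma moment_cvg s : cvgn (moment s).
Proof.
elim/ltn_ind: s => -[_|s IH].
  apply: is_cvgn_near (is_cvgn_cst 1); near=> n.
  by rewrite /moment; under eq_fun do rewrite expr0; rewrite avg_cst.
have cd : cvgn (fun n => (d n)%:R / n%:R : R) by apply/cvg_ex; exists delta.
have ch : cvgn scale by apply/cvg_ex; exists 0; exact: scale_cvg0.
have cQ : coefcvg (fun n => stein_quot s (scale n)).
  apply: coefcvg_sum => i; apply: coefcvgM; first exact: coefcvg_cst.
  apply: coefcvgX; apply: coefcvgD; first exact: coefcvg_cst.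
  by under eq_fun do rewrite -polyCN -mulN1r; apply/coefcvgC/is_cvgn_mul => //; apply: is_cvgn_cst.
have cd2 : cvgn (fun n => (1 - (d n)%:R / n%:R : R) ^+ 2).
  apply: is_cvgn_exp; apply: is_cvgn_add; first exact: is_cvgn_cst.
  by under eq_fun do rewrite -mulN1r; apply: is_cvgn_mul => //; apply: is_cvgn_cst.
(* Expanding the two brackets of [stein_moment], [p] collects terms of degree at most [s], settled
   by induction; [q] may reach degree [s.+1] but comes with the factor [scale n ^+ 2]. *)
pose p n : {poly R} := (((d n)%:R / n%:R) ^+ 2 * (1 - (d n)%:R / n%:R) ^+ 2)%:P
    * stein_quot s (scale n)
  + ((((d n)%:R / n%:R) ^+ 2 + (1 - (d n)%:R / n%:R) ^+ 2) * scale n)%:P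
    * ('X * stein_quot s (scale n)).
pose q n : {poly R} := 'X ^+ 2 * stein_quot s (scale n).
have sX (r : {poly R}) : (size ('X * r)%R <= (size r).+1)%N.
  by apply: leq_trans (size_polyMleq _ _) _; rewrite size_polyX.
have sC (c : R) (r : {poly R}) : (size (c%:P * r)%R <= size r)%N.
  by rewrite mul_polyC; apply: size_scale_leq.
have sQ n := size_stein_quot s (scale n).
have cvgp : cvgn (fun n => avg R n (d n) (fun y => (p n).[y * scale n])).
  apply: (avg_poly_cvg _ s.+1) => [n||i]; last exact: IH.
    apply: (leq_trans (size_polyD _ _)); rewrite geq_max; apply/andP; split.
      by apply: (leq_trans (sC _ _)); apply: leqW.
    by apply: (leq_trans (sC _ _)); apply: leq_trans (sX _) _; rewrite ltnS.
  apply: coefcvgD; apply: coefcvgM.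
  - by apply: coefcvgC; apply: is_cvgn_mul => //; apply: is_cvgn_exp.
  - exact: cQ.
  - apply: coefcvgC; apply: is_cvgn_mul => //; apply: is_cvgn_add => //; exact: is_cvgn_exp.
  - by apply: coefcvgM => //; apply: coefcvg_cst.
have sq n : (size (q n) <= s.+2)%N.
  rewrite /q expr2 -mulrA; apply: leq_trans (sX _) _; rewrite ltnS.
  by apply: leq_trans (sX _) _; rewrite ltnS.
have cvgq : cvgn (fun n => scale n ^+ 2 * avg R n (d n) (fun y => (q n).[y * scale n])).
  under eq_fun => n do rewrite (avg_polyE _ _ _ (sq n)) mulr_sumr.
  apply: is_cvgn_sum => i; under eq_fun => n do rewrite mulrCA.
  apply: is_cvgn_mul; first by apply: coefcvgM => //; apply: coefcvg_cst.
  (* The moment of order [s.+1] may occur here, so only the a priori bound [moment_le] is used. *)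
  apply/cvg_ex; exists 0; apply: (cvgn_bounded_mul0 _ _ (32 ^+ i * i`!%:R * avg_bound R)).
    rewrite -[X in _ --> X](mulr0 0); apply: cvgM; exact: scale_cvg0.
  by near=> n; apply: moment_le; near: n; exists 1%N.
apply: is_cvgn_near (is_cvgn_add _ _ cvgp cvgq); near=> n.
have n0 : (0 < n)%N by near: n; exists 1%N.
rewrite stein_moment // -avgZ -avgD; congr avg; apply/funext => y.
rewrite /p /q !(hornerD, hornerM, hornerC, hornerX, hornerXn).
by ring.
Unshelve. all: by end_near. Qed.

End Convergence.

(** * The ratio of the moments *)

Section Density.
Variables (R : realType) (z : R).
Hypothesis z01 : 0 < z < 1.

Definition weight n : nat := Num.truncn (z * n%:R).
Definition density n : R := (weight n)%:R / n%:R.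

Lemma truncn_dist (x : R) : 0 <= x -> `|(Num.truncn x)%:R - x| <= 1.
Proof.
move=> x0; have /andP[] := truncn_itv x0; rewrite -natr1 => a b.
by rewrite ler_norml; apply/andP; split; lra.
Qed.

Lemma truncn_cvg (x : R) : 0 <= x ->
  (fun n => (Num.truncn (x * n%:R))%:R / n%:R) @ \oo --> x.
Proof.
move=> x0; apply/cvgrPdist_le => e e0; near=> n.
have n0 : 0 < n%:R :> R by rewrite ltr0n; near: n; exists 1%N.
have -> : x - (Num.truncn (x * n%:R))%:R / n%:R
   = - ((Num.truncn (x * n%:R))%:R - x * n%:R) / n%:R by field; exact: lt0r_neq0.
rewrite normrM normrN normfV (gtr0_norm n0) ler_pdivrMr //.
apply: le_trans (truncn_dist _ (mulr_ge0 x0 (ltW n0))) _.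
rewrite -ler_pdivrMl // mulr1; near: n; exact: nbhs_infty_ger.
Unshelve. all: by end_near. Qed.

Lemma weight_le n : (weight n <= n)%N.
Proof.
case/andP: z01 => z0 z1; rewrite -(ler_nat R) /weight.
apply: (@le_trans _ _ (z * n%:R)); first by rewrite truncn_le mulr_ge0 // ltW.
by rewrite ler_piMl // ltW.
Qed.

Lemma density_cvg : density @ \oo --> z.
Proof. by apply: truncn_cvg; case/andP: z01 => /ltW. Qed.

Lemma density_dist n : (0 < n)%N -> `|(density n - z) * n%:R| <= 1.
Proof.
move=> n0; have n0' : n%:R != 0 :> R by rewrite pnatr_eq0 -lt0n.
rewrite mulrBl /density divfK //; apply: truncn_dist.
by rewrite mulr_ge0 // ltW //; case/andP: z01.
Qed.

Lemma horner_density_cvg (p : {poly R}) : (fun n => p.[density n]) @ \oo --> p.[z].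
Proof. exact: (cvg_comp _ _ density_cvg (@continuous_horner R p z)). Qed.

Lemma is_cvgn_bounded (u : nat -> R) :
  cvgn u -> exists2 K, 0 <= K & \forall n \near \oo, `|u n| <= K.
Proof.
case/cvg_ex => l /cvgrPdist_lt/(_ 1 ltr01) H; exists (`|l| + 1); first exact: addr_ge0.
near=> n; have : `|l - u n| < 1 by near: n.
have := ler_normB l (l - u n); rewrite opprB addrC subrK; lra.
Unshelve. all: by end_near. Qed.

(** * The normalised excess of the pair probability over independence *)

Variables (I : pred nat) (k : nat).
Hypothesis g0 : 0 < (level R I k finset.set0).[z].
Hypothesis crit : forall i : 'I_k, root (level R I k [set i]%SET) z.

Definition level_ratio (S : {set 'I_k}) n : R :=
  ((level R I k S).[density n] / (level R I k finset.set0).[density n]) ^+ 2.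

Lemma level0_near_gt0 : \forall n \near \oo, 0 < (level R I k finset.set0).[density n].
Proof. exact: (cvgr_gt _ (horner_density_cvg _)). Qed.

Lemma is_cvgn_ratio (p : {poly R}) :
  cvgn (fun n => (p.[density n] / (level R I k finset.set0).[density n]) ^+ 2).
Proof.
apply: is_cvgn_exp; apply: is_cvgn_mul.
  apply/cvg_ex; eexists; exact: horner_density_cvg.
apply/cvg_ex; exists ((level R I k finset.set0).[z]^-1).
by apply: cvgV; [exact: lt0r_neq0|exact: horner_density_cvg].
Qed.

(** Normalised so that [coeff S n * (y * scale n) ^+ #|S| / n] is
    [level_ratio S n * (y / n) ^+ #|S|]. *)
Definition coeff (S : {set 'I_k}) n : R := level_ratio S n * n%:R * scale R n ^+ #|S|.

Lemma level1_ratio i : exists q : {poly R}, forall n,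
  level_ratio [set i]%SET n =
   (density n - z) ^+ 2 * (q.[density n] / (level R I k finset.set0).[density n]) ^+ 2.
Proof.
have /factor_theorem[q Hq] := crit i; exists q => n.
by rewrite /level_ratio Hq hornerM hornerXsubC -exprMn; congr (_ ^+ 2); ring.
Qed.

Lemma density_sqr n : (0 < n)%N -> (density n - z) ^+ 2 * n%:R ^+ 2 <= 1.
Proof.
move=> n0; rewrite -exprMn -real_normK ?num_real // expr_le1 //.
exact: density_dist.
Qed.

(* For [#|S| = 1], the root [z] of [level] makes the ratio [O(1 / n^2)]. *)
Lemma coeff_cvg S : S != finset.set0 -> cvgn (coeff S).
Proof.
move=> S0; have [/eqP/cards1P[i ->]|S1] := eqVneq #|S| 1%N.
  have [q Hq] := level1_ratio i.
  have /cvg_ex[l Hl] := is_cvgn_ratio q.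
  apply/cvg_ex; exists 0; apply/cvgr0Pnorm_le => e e0.
  have H : (fun n => scale R n *
      ((q.[density n] / (level R I k finset.set0).[density n]) ^+ 2)) @ \oo --> (0 : R).
    rewrite -[X in _ --> X](mul0r l); apply: cvgM Hl; exact: scale_cvg0.
  move/cvgr0Pnorm_le/(_ e e0) : H => H; near=> n.
  have n0 : (0 < n)%N by near: n; exists 1%N.
  have N0 : 0 < n%:R :> R by rewrite ltr0n.
  apply: (@le_trans _ _ `|scale R n *
    (q.[density n] / (level R I k finset.set0).[density n]) ^+ 2|); last by near: n.
  rewrite /coeff cards1 expr1 Hq.
  have -> : forall a b c e : R, a * b * c * e = (a * c) * (e * b) by move=> *; ring.
  rewrite normrM ler_piMl //.
  rewrite (ger0_norm (mulr_ge0 (sqr_ge0 _) (ler0n _ _))).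
  apply: le_trans (density_sqr n n0); rewrite ler_wpM2l ?sqr_ge0 //.
  by rewrite expr2 ler_pMr // ler1n.
(* For larger [S], two factors [scale] cancel [n], and the remaining powers converge. *)
have S2 : (1 < #|S|)%N by rewrite ltn_neqAle eq_sym S1 card_gt0.
have H : cvgn (fun n => level_ratio S n * scale R n ^+ (#|S| - 2)).
  apply: is_cvgn_mul; first exact: is_cvgn_ratio.
  by apply: is_cvgn_exp; apply/cvg_ex; exists 0; exact: scale_cvg0.
apply: is_cvgn_near H; near=> n.
have n0 : (0 < n)%N by near: n; exists 1%N.
have N0 : n%:R != 0 :> R by rewrite pnatr_eq0 -lt0n.
rewrite /coeff -[in RHS](subnK S2) exprD scale_sqr //.
by move: (level_ratio S n) (_ ^+ (#|S| - 2)) => a b; field.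
Unshelve. all: by end_near. Qed.

(** For singletons the rounding error of the density makes the term bounded. Otherwise
    [|y / n| <= 1] lets the exponent [#|S|] be lowered to 2, which leaves [y ^+ 2 / n]. *)
Lemma coeff_dominated S : exists2 K, 0 <= K & \forall n \near \oo, S != finset.set0 ->
  forall y, `|y| <= n%:R ->
    `|coeff S n * (y * scale R n) ^+ #|S| | <= K * (1 + y ^+ 2 / n%:R).
Proof.
have coeffE n y : (0 < n)%N -> coeff S n * (y * scale R n) ^+ #|S|
    = level_ratio S n * n%:R * (y / n%:R) ^+ #|S|.
  by move=> n0; rewrite /coeff -scale_sqr // -[LHS]mulrA -exprMn; congr (_ * _ ^+ _); ring.
have [/eqP/cards1P[i Si]|S1] := eqVneq #|S| 1%N.
  have [q Hq] := level1_ratio i.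
  have [K K0 HK] := is_cvgn_bounded _ (is_cvgn_ratio q); exists K => //.
  near=> n => _ y yn.
  have n0 : (0 < n)%N by near: n; exists 1%N.
  have N0 : 0 < n%:R :> R by rewrite ltr0n.
  rewrite coeffE // Si cards1 expr1 Hq.
  have Y0 : 0 <= y ^+ 2 / n%:R by rewrite divr_ge0 ?sqr_ge0 ?ltW.
  apply: (@le_trans _ _ K); last by rewrite ler_peMr // lerDl.
  have HKn : `|(q.[density n] / (level R I k finset.set0).[density n]) ^+ 2| <= K by near: n.
  have yn1 : `|y / n%:R| <= 1.
    by rewrite normrM normfV (gtr0_norm N0) ler_pdivrMr // mul1r.
  have -> : forall a b c e : R, a * b * c * e = (a * c * e) * b by move=> *; ring.
  rewrite normrM -[leRHS]mul1r ler_pM // normrM mulr_ile1 //.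
  rewrite (ger0_norm (mulr_ge0 (sqr_ge0 _) (ler0n _ _))).
  apply: le_trans (density_sqr n n0); rewrite ler_wpM2l ?sqr_ge0 //.
  by rewrite expr2 ler_pMr // ler1n.
have [K K0 HK] := is_cvgn_bounded _ (is_cvgn_ratio (level R I k S)); exists K => //.
near=> n => S0 y yn.
have n0 : (0 < n)%N by near: n; exists 1%N.
have N0 : 0 < n%:R :> R by rewrite ltr0n.
have S2 : (1 < #|S|)%N by rewrite ltn_neqAle eq_sym S1 card_gt0.
have HKn : `|level_ratio S n| <= K by near: n.
have yn1 : `|y / n%:R| <= 1.
  by rewrite normrM normfV (gtr0_norm N0) ler_pdivrMr // mul1r.
rewrite coeffE // -mulrA normrM ler_pM //.
rewrite normrM normrX (gtr0_norm N0).
apply: (@le_trans _ _ (n%:R * `|y / n%:R| ^+ 2)).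
  by rewrite ler_wpM2l ?ler0n // ler_wiXn2l.
rewrite real_normK ?num_real // [leLHS](_ : _ = y ^+ 2 / n%:R); first by rewrite lerDr.
by field; exact: lt0r_neq0.
Unshelve. all: by end_near. Qed.

(** At [y * scale n], this is [n] times the relative excess over [g ^+ 2] of the probability that a
    constraint is satisfied by both valuations. *)
Definition excess n : {poly R} := \sum_(S | S != finset.set0) (coeff S n)%:P * 'X^#|S|.

Lemma excess_coefcvg : coefcvg R excess.
Proof.
rewrite /excess; under eq_fun do rewrite big_mkcond.
apply: coefcvg_sum => S; case: (boolP (S != finset.set0)) => S0; last exact: coefcvg_cst.
by apply: coefcvgM; [apply: coefcvgC; apply: coeff_cvg|apply: coefcvg_cst].
Qed.

Lemma size_excess n : (size (excess n) <= k.+1)%N.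
Proof.
apply: (leq_trans (size_sum _ _ _)); apply/bigmax_leqP => S _.
rewrite mul_polyC; apply: (leq_trans (size_scale_leq _ _)).
by rewrite size_polyXn ltnS -[leqRHS]card_ord max_card.
Qed.

Lemma excess_dominated : exists2 K, 0 < K & \forall n \near \oo,
  forall y, `|y| <= n%:R -> `|(excess n).[y * scale R n]| <= K * (1 + y ^+ 2 / n%:R).
Proof.
have /choice[K HK] : forall S, exists K, 0 <= K /\ \forall n \near \oo, S != finset.set0 ->
  forall y, `|y| <= n%:R ->
    `|coeff S n * (y * scale R n) ^+ #|S| | <= K * (1 + y ^+ 2 / n%:R).
  by move=> S; have [K ? ?] := coeff_dominated S; exists K.
exists (1 + \sum_S K S).
  by rewrite ltr_pwDl // sumr_ge0 // => S _; have [] := HK S.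
have := filter_forall _ (fun S => (HK S).2).
move=> H; near=> n => y yn.
have Hn : forall S, S != finset.set0 -> forall y, `|y| <= n%:R ->
    `|coeff S n * (y * scale R n) ^+ #|S| | <= K S * (1 + y ^+ 2 / n%:R).
  by near: n; exact: H.
have Y0 : 0 <= y ^+ 2 / n%:R by rewrite divr_ge0 ?sqr_ge0.
rewrite horner_sum; apply: le_trans (ler_norm_sum _ _ _) _.
apply: (@le_trans _ _ (\sum_S K S * (1 + y ^+ 2 / n%:R))).
  rewrite big_mkcond; apply: ler_sum => S _; case: ifPn => S0.
    by rewrite hornerM hornerC hornerXn; apply: Hn.
  by rewrite mulr_ge0 ?addr_ge0 //; have [] := HK S.
by rewrite -mulr_suml ler_wpM2r ?addr_ge0 // lerDr.
Unshelve. all: by end_near. Qed.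

(** * The second moment over the squared first moment, as an average, and its limit *)

Definition ratio_sum (m n : nat) : R :=
  avg R n (weight n) (fun y => (1 + (excess n).[y * scale R n] / n%:R) ^+ m).

Lemma EX2_ratio m n : (0 < n)%N -> 0 < (level R I k finset.set0).[density n] ->
  EX2 I n k m (weight n) = ratio_sum m n * EX I n k m (weight n) ^+ 2.
Proof.
move=> n0 gn0; have N0 : n%:R != 0 :> R by rewrite pnatr_eq0 -lt0n.
rewrite EX2_slice // EX_slice // -/(density n) /ratio_sum /avg.
have D0 : #|slice n (weight n)|%:R != 0 :> R by rewrite pnatr_eq0 -lt0n slice_gt0 // weight_le.
rewrite exprMn mulrA divfK ?expf_neq0 // mulr_suml; apply: eq_bigr => s _.
rewrite mulr_suml; apply: eq_bigr => t _.
rewrite -exprM mulnC exprM -exprMn; congr (_ ^+ m).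
rewrite (bigD1 finset.set0) //= cards0 expr0 mulr1 [in RHS]mulrDl mul1r; congr (_ + _).
rewrite horner_sum !mulr_suml; apply: eq_bigr => S _.
rewrite hornerM hornerC hornerXn /coeff /level_ratio.
rewrite (_ : dev R s t / n%:R = dev R s t * scale R n * scale R n); last first.
  by rewrite -scale_sqr // expr2 mulrA.
rewrite [in LHS]exprMn.
move: (scale R n ^+ #|S|) ((dev R s t * scale R n) ^+ #|S|) => a b.
by field; rewrite N0 lt0r_neq0.
Qed.

Lemma EX_gt0 m n : (0 < n)%N -> 0 < (level R I k finset.set0).[density n] ->
  0 < EX I n k m (weight n) :> R.
Proof.
move=> n0 gn0; rewrite EX_slice // mulr_gt0 ?exprn_gt0 //.
by rewrite ltr0n slice_gt0 // weight_le.
Qed.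

(** Passing from [j] to [j.+1] multiplies the quotient by [(m / n - j / n) / j.+1], which
    converges. *)
Lemma binomial_cvg (r : R) j : 0 <= r ->
  cvgn (fun n => 'C(Num.truncn (r * n%:R), j)%:R / n%:R ^+ j : R).
Proof.
move=> r0; elim: j => [|j IH].
  by under eq_fun do rewrite bin0 expr0 divr1; apply: is_cvgn_cst.
have H : cvgn (fun n => 'C(Num.truncn (r * n%:R), j)%:R / n%:R ^+ j *
    (((Num.truncn (r * n%:R))%:R / n%:R - j%:R * scale R n ^+ 2) / j.+1%:R)).
  apply: is_cvgn_mul => //; apply: is_cvgn_mul; last exact: is_cvgn_cst.
  apply: is_cvgn_add; first by apply/cvg_ex; exists r; apply: truncn_cvg.
  under eq_fun do rewrite -mulNr.
  apply: is_cvgn_mul; first exact: is_cvgn_cst.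
  by apply: is_cvgn_exp; apply/cvg_ex; exists 0; exact: scale_cvg0.
apply: is_cvgn_near H; near=> n.
have n0 : (0 < n)%N by near: n; exists 1%N.
have N0 : n%:R != 0 :> R by rewrite pnatr_eq0 -lt0n.
set m := Num.truncn _; rewrite scale_sqr //.
have -> : 'C(m, j.+1)%:R = (m%:R - j%:R) * 'C(m, j)%:R / j.+1%:R :> R.
  apply: canRL (mulfK _) _; first by rewrite pnatr_eq0.
  rewrite mulrC -natrM mul_bin_left natrM.
  (* When [m < j] the natural subtraction is truncated, but ['C(m, j)] is then 0. *)
  by have [jm|mj] := leqP j m; [rewrite natrB|rewrite bin_small // !mulr0].
rewrite exprS; field.
by rewrite N0 expf_neq0 // addrC natr1 pnatr_eq0.
Unshelve. all: by end_near. Qed.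

Lemma binomial_le m j : 'C(m, j)%:R <= m%:R ^+ j / j`!%:R :> R.
Proof.
rewrite ler_pdivlMr ?ltr0n ?fact_gt0 // -natrM bin_ffact -natrX ler_nat.
elim: j m => [|j IH] m; first by rewrite ffactn0.
rewrite ffactnS expnS leq_mul //; apply: leq_trans (IH _) _.
by case: j {IH} => // j; rewrite leq_exp2r // leq_pred.
Qed.

Lemma ratio_sum_cvg : exists2 rstar : R, 0 < rstar & forall r, 0 < r < rstar ->
  cvgn (fun n => ratio_sum (Num.truncn (r * n%:R)) n).
Proof.
(* The binomial term of index [j] will be at most [avg_bound * (32 * K * r) ^+ j], the two
   factorials cancelling; this threshold makes the base at most 1/2, as [tannery] requires. *)
have [K K0 HK] := excess_dominated; exists (64 * K)^-1.
  by rewrite invr_gt0 mulr_gt0.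
move=> r /andP[r0 rK].
pose m n := Num.truncn (r * n%:R).
pose t j n : R := 'C(m n, j)%:R / n%:R ^+ j *
   avg R n (weight n) (fun y => (excess n ^+ j).[y * scale R n]).
suff H : cvgn (fun n => \sum_(j < (m n).+1) t j n).
  apply: is_cvgn_near H; near=> n.
  have n0 : (0 < n)%N by near: n; exists 1%N.
  have N0 : n%:R != 0 :> R by rewrite pnatr_eq0 -lt0n.
  rewrite /ratio_sum -/(m n).
  under [in RHS]eq_fun => y do rewrite exprDn.
  rewrite avg_sum; apply: eq_bigr => j _; rewrite /t -avgZ; congr avg; apply/funext => y.
  rewrite expr1n mul1r horner_exp expr_div_n -[RHS]mulr_natl; ring.
apply: (tannery _ _ _ (avg_bound R)).
- move=> j; apply: is_cvgn_mul; first exact/binomial_cvg/ltW.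
  apply: (avg_poly_cvg R weight (fun n => excess n ^+ j) (k * j).+1).
  + move=> n; apply: (leq_trans (size_poly_exp_leq _ _)); rewrite ltnS leq_mul2r.
    by rewrite -subn1 leq_subLR add1n size_excess orbT.
  + exact: coefcvgX excess_coefcvg.
  + move=> i _; exact: (moment_cvg _ _ z weight_le density_cvg).
- by move=> j n mj; rewrite /t bin_small // !mul0r.
near=> n => j.
have n0 : (0 < n)%N by near: n; exists 1%N.
have N0 : 0 < n%:R :> R by rewrite ltr0n.
have HKn : forall y, `|y| <= n%:R -> `|(excess n).[y * scale R n]| <= K * (1 + y ^+ 2 / n%:R).
  by near: n.
have F0 : 0 < j`!%:R :> R by rewrite ltr0n fact_gt0.
have B0 : 0 < avg_bound R by rewrite /avg_bound !mulr_gt0 ?expR_gt0.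
have a1 : `|avg R n (weight n) (fun y => (excess n ^+ j).[y * scale R n])|
    <= K ^+ j * (32 ^+ j * j`!%:R * avg_bound R).
  apply: le_trans (avg_norm _ _ _ _ n0 (weight_le n)) _.
  apply: (@le_trans _ _ (avg R n (weight n) (fun y => K ^+ j * (1 + y ^+ 2 / n%:R) ^+ j))).
    apply: avg_le => // [|y yn]; first exact: weight_le.
    rewrite horner_exp normrX -exprMn lerXn2r ?nnegrE ?HKn //.
    by rewrite mulr_ge0 ?addr_ge0 ?divr_ge0 ?sqr_ge0 ?ler0n ?(ltW K0).
  by rewrite avgZ ler_wpM2l ?exprn_ge0 ?(ltW K0) // avg_pow // weight_le.
have a2 : 'C(m n, j)%:R / n%:R ^+ j <= r ^+ j / j`!%:R.
  rewrite ler_pdivrMr ?exprn_gt0 //; apply: le_trans (binomial_le _ _) _.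
  rewrite mulrAC ler_wpM2r ?invr_ge0 ?ler0n // -exprMn.
  rewrite lerXn2r ?nnegrE ?mulr_ge0 ?ler0n ?(ltW r0) //.
  by rewrite truncn_le mulr_ge0 // ltW.
rewrite /t normrM ger0_norm ?divr_ge0 ?exprn_ge0 ?ler0n //.
apply: (@le_trans _ _ (r ^+ j / j`!%:R * (K ^+ j * (32 ^+ j * j`!%:R * avg_bound R)))).
  by rewrite ler_pM // divr_ge0 ?exprn_ge0 ?ler0n.
have -> : r ^+ j / j`!%:R * (K ^+ j * (32 ^+ j * j`!%:R * avg_bound R))
   = avg_bound R * (r * K * 32) ^+ j.
  by rewrite !exprMn; field; exact: lt0r_neq0.
rewrite ler_wpM2l ?(ltW B0) // -exprVn.
rewrite lerXn2r ?nnegrE ?invr_ge0 ?mulr_ge0 ?(ltW K0) ?(ltW r0) //.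
have : r * (64 * K) < 1 by rewrite -ltr_pdivlMr ?mulr_gt0 // mul1r.
lra.
Unshelve. all: by end_near. Qed.

End Density.

Theorem mainTheorem1 (R : realType) (k : nat) (I : pred nat) :
  (2 <= k)%N ->
  (exists j, I j) ->
  (forall j, I j -> (0 < j < k)%N) ->
  exists rstar : R, 0 < rstar /\
  exists delta : R, 0 < delta < 1 /\
  forall r : R, 0 < r < rstar ->
    exists l : R, 0 < l /\ ((fun n : nat => moment_ratio I k r delta n) @ \oo --> l).
Proof.
move=> _ [j Ij] HI.
have [z [z01 g0 crit]] := level0_critical R I k j Ij HI.
have [rstar rs0 H] := ratio_sum_cvg R z z01 I k g0 crit.
exists rstar; split=> //; exists z; split=> // r rr.
have /cvg_ex[l Hl] := H r rr.
have gpos := level0_near_gt0 R z z01 I k g0.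
(* Since [EX ^+ 2 <= EX2], the ratio is eventually at least 1; its limit is thus nonzero and may be
   inverted. *)
have l1 : 1 <= l.
  apply: (cvgr_to_ge Hl); near=> n.
  have n0 : (0 < n)%N by near: n; exists 1%N.
  have gn : 0 < (level R I k finset.set0).[density R z n] by near: n.
  have e0 := EX_gt0 R z z01 I k (Num.truncn (r * n%:R)) n n0 gn.
  rewrite -(ler_pM2r (exprn_gt0 2 e0)) mul1r -EX2_ratio //; exact: EX2_ge.
exists l^-1; split; first by rewrite invr_gt0 (lt_le_trans ltr01).
have lV : (fun n => (ratio_sum R z I k (Num.truncn (r * n%:R)) n)^-1) @ \oo --> l^-1.
  by apply: cvgV Hl; rewrite gt_eqF // (lt_le_trans ltr01).
apply: cvg_trans lV; apply: near_eq_cvg; near=> n.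
have n0 : (0 < n)%N by near: n; exists 1%N.
have gn : 0 < (level R I k finset.set0).[density R z n] by near: n.
rewrite /moment_ratio -/(weight R z n) EX2_ratio //.
have e0 := EX_gt0 R z z01 I k (Num.truncn (r * n%:R)) n n0 gn.
move: (EX _ _ _ _ _) (ratio_sum _ _ _ _ _ _) e0 => E T e0.
by rewrite invfM mulrCA divff ?mulr1 // expf_neq0 // lt0r_neq0.
Unshelve. all: by end_near. Qed.
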